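(* Let $m$ be an odd positive integer, let $V$ be a vector space of dimension $m$ over $\mathbb{F}_2$, and let $f: V \to V$ be a function with $f(0)=0$. If the graph $G_f$ is distance-regular with intersection array \[ \{ 2^{m+1}-1,\ 2^{m+1}-2,\ 1;\ 1,\ 2,\ 2^{m+1}-1 \}, \] then $f$ is crooked.
   Context: Let $V = V(m,2)$ be a vector space of dimension $m$ over $\mathbb{F}_2$ with $m$ odd. Crooked: a function $f: V \to V$ is crooked if the following three conditions hold: (1) $f(0)=0$; (2) $f(x)+f(y)+f(z) \neq f(x+y+z)$ for all distinct $x,y,z \in V$ (pairwise distinct); (3) $f(x)+f(y)+f(z) \neq f(x+a)+f(y+a)+f(z+a)$ for all $x,y,z \in V$ (not necessarily distinct) and all $a \in V$ with $a \neq 0$. The graph $G_f$ (the crooked graph of $f$): for $f: V \to V$ with $f(0)=0$, $G_f$ is the simple undirected graph with vertex set $V \times \mathbb{F}_2 \times V$ in which two distinct vertices $(a,i,\alpha)$ and $(b,j,\beta)$ are adjacent if and only if \[ \alpha + \beta = f(a+b) + (i+j+1)\,(f(a)+f(b)), \] where $i+j+1$ is computed in $\mathbb{F}_2$ and acts as a scalar on $V$. Distance-regular with intersection array $\{b_0,b_1,b_2;c_1,c_2,c_3\}$ means: the graph is connected of diameter $3$ and, for any two vertices $u,v$ at distance $d$, the number of neighbours of $v$ at distance $d+1$ from $u$ is $b_d$ (for $d=0,1,2$), and the number of neighbours of $v$ at distance $d-1$ from $u$ is $c_d$ (for $d=1,2,3$). *)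

(* Defs.v *)
From mathcomp Require Import all_boot all_algebra finfield.

Set Implicit Arguments.
Unset Strict Implicit.
Unset Printing Implicit Defensive.

Import GRing.Theory.
Local Open Scope ring_scope.

Section Graph.
Variables (T : finType) (e : rel T).

Definition walk (n : nat) (u v : T) : bool :=
  [exists p : n.-tuple T, path e u p && (last u p == v)].

Definition at_distance (d : nat) (u v : T) : bool :=
  walk d u v && [forall k : 'I_d, ~~ walk k u v].

Definition has_diameter (D : nat) : Prop :=
  (forall u v, exists2 d, (d <= D)%N & at_distance d u v)
  /\ (exists u v, at_distance D u v).

(* The intersection array {b_0, ..., b_(D-1); c_1, ..., c_D} is given by the
   sequences b and c of common size D; note that c_d is nth 0 c d.-1. *)
Definition distance_regular (b c : seq nat) : Prop :=
  [/\ size c = size b,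
      forall u v, connect e u v,
      has_diameter (size b),
      forall d u v, (d < size b)%N -> at_distance d u v ->
        #|[set w | e v w & at_distance d.+1 u w]| = nth 0%N b d
    & forall d u v, (0 < d <= size c)%N -> at_distance d u v ->
        #|[set w | e v w & at_distance d.-1 u w]| = nth 0%N c d.-1].

End Graph.

Section Crooked.
Variables (V : lmodType 'F_2) (f : V -> V).

Definition crooked : Prop :=
  [/\ f 0 = 0,
      forall x y z, x != y -> x != z -> y != z ->
        f x + f y + f z != f (x + y + z)
    & forall x y z a, a != 0 ->
        f x + f y + f z != f (x + a) + f (y + a) + f (z + a)].

Definition crooked_graph : rel (V * 'F_2 * V) :=
  fun u v => let: (a, i, alpha) := u in let: (b, j, beta) := v in
    (u != v) && (alpha + beta == f (a + b) + (i + j + 1) *: (f a + f b)).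

Lemma crooked_graph_irrefl : irreflexive crooked_graph.
Proof. by case=> [[a i] alpha]; rewrite /crooked_graph eqxx. Qed.

Lemma crooked_graph_sym : symmetric crooked_graph.
Proof.
case=> [[a i] alpha] [[b j] beta]; rewrite /crooked_graph eq_sym.
by rewrite (addrC alpha) (addrC a) (addrC i) (addrC (f a)).
Qed.

End Crooked.

(* A vectType over a finite field is not canonically a finType; its copy
   finvect_type V, convertible to V, is. *)
Definition crooked_vertex (V : vectType 'F_2) : finType :=
  (finvect_type V * 'F_2 * finvect_type V)%type.

(* Main.v *)
Require Import Defs.
From mathcomp Require Import all_boot all_algebra finfield.
Import GRing.Theory.
Local Open Scope ring_scope.

(** Write a vertex as [(p, alpha)], where the fibre [p] ranges over the pairs
    in [V * 'F_2]. Two vertices in distinct fibres [p] and [q] are adjacent iff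
    [alpha + beta = edge_label f p q], so [crooked_graph f] is a cover of a
    complete graph, and the paths of length 2 from [(p, 0)] to [(q, t)]
    correspond to the fibres [r], other than [p] and [q], with
    [edge_label f p r + edge_label f r q = t].

    The intersection array gives [b_1 = b_0 - 1], hence there are no triangles,
    and [c_2 = 2], hence nonadjacent vertices have at most two common
    neighbours. As the two excluded fibres [p] and [q] both give the value
    [edge_label f p q], which no other fibre may give in a triangle-free graph,
    the function [r |-> edge_label f p r + edge_label f r q] takes every value
    at most twice ([size_two_step_le2]).

    For [p = (x, 0)] and [q = (x + d, 0)], with [d] nonzero, this function is,
    up to a change of variables, [(z, k) |-> D z + k *: D x], where
    [D z = f z + f (z + d)] ([size_derivative_fibre_le2]). Since [D] is
    invariant under translation by [d], each value it takes is taken twice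
    already. If [f x + f y + f z = f (x + y + z)] with [x], [y], [z] distinct,
    then for [d = x + y] the points [x], [y], [z] have the same image under
    [D]; if [D x + D y + D z = 0], then the value [D y] is taken at [(y, 0)],
    [(y + d, 0)] and [(z, 1)]. Both are impossible, so [f] is crooked. *)

(** * Local consequences of distance-regularity *)

Section DistanceRegular.
Context {T : finType} {e : rel T}.

Lemma walk0 u v : walk e 0 u v = (u == v).
Proof.
apply/existsP/idP => [[p]|/eqP->]; first by rewrite tuple0 /=.
by exists [tuple]; rewrite /= eqxx.
Qed.

Lemma walk1 u v : walk e 1 u v = e u v.
Proof.
apply/existsP/idP => [[p]|euv].
  by case/tupleP: p => w p; rewrite tuple0 /= andbT => /andP[euw /eqP <-].
by exists [tuple v]; rewrite /= euv eqxx.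
Qed.

Lemma at_distance0 u v : at_distance e 0 u v = (u == v).
Proof.
by rewrite /at_distance walk0; case: (u == v) => //=; apply/forallP => -[].
Qed.

Lemma at_distance1 u v : at_distance e 1 u v = e u v && (u != v).
Proof.
rewrite /at_distance walk1; congr (_ && _); apply/forallP/idP.
  by move/(_ ord0); rewrite walk0.
by move=> neq_uv k; rewrite ord1 walk0.
Qed.

Lemma at_distance2 u w v :
  u != v -> ~~ e u v -> e u w -> e w v -> at_distance e 2 u v.
Proof.
move=> neq_uv nadj euw ewv; apply/andP; split.
  by apply/existsP; exists [tuple w; v]; rewrite /= euw ewv eqxx.
by apply/forallP => -[[|[|//]] ltk] /=; rewrite ?walk0 ?walk1.
Qed.

Context (irr : irreflexive e) (sym : symmetric e).

Lemma at_distance1_irr u v : at_distance e 1 u v = e u v.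
Proof.
by rewrite at_distance1; case: eqP => [->|]; rewrite ?irr ?andbT.
Qed.

(** If [u] and [v] are adjacent, at most one of the [b_0] neighbours of [v] is
    not at distance 2 from [u]. That one is [u] itself, which leaves no room for
    a common neighbour of [u] and [v]. *)
Lemma distance_regular_triangle_free b c :
  distance_regular e b c -> (1 < size b)%N ->
  (nth 0 b 0 <= (nth 0 b 1).+1)%N ->
  forall u v w, e u v -> e v w -> ~~ e u w.
Proof.
case=> _ _ _ regb _ size_b le_b u v w euv evw; apply/negP => euw.
have dist1_uv : at_distance e 1 u v by rewrite at_distance1_irr.
have dist0_vv : at_distance e 0 v v by rewrite at_distance0.
have deg_v := regb 0 v v (ltnW size_b) dist0_vv.
have far_v := regb 1 u v size_b dist1_uv.
move: le_b; rewrite -deg_v -far_v leqNgt => /negP; apply.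
pose far := [set w | e v w & at_distance e 2 u w].
have not_far x : walk e 0 u x || walk e 1 u x -> x \notin far.
  move=> near; rewrite inE negb_and; apply/orP; right.
  apply/negP => /andP[_ /forallP noshort].
  by case/orP: near; apply/negP; [apply: (noshort ord0)|apply: (noshort ord_max)].
have u_notin : u \notin far by rewrite not_far ?walk0 ?eqxx.
have w_notin : w \notin far by rewrite not_far ?walk1 ?euw ?orbT.
have neq_uw : u != w by apply: contraTneq euw => ->; rewrite irr.
have -> : (#|far|.+2 = #|u |: (w |: far)|)%N.
  by rewrite !cardsU1 w_notin in_setU1 negb_or neq_uw u_notin.
apply/subset_leq_card/subsetP => x; rewrite !inE at_distance1_irr andbb.
case/or3P => [/eqP->|/eqP->|/andP[]//]; last exact: evw.
by rewrite sym.
Qed.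

(** Only an inequality, because [u] and [v] may be at distance more than 2. *)
Lemma distance_regular_common_neighbours b c :
  distance_regular e b c -> (1 < size c)%N ->
  forall u v, u != v -> ~~ e u v ->
    (#|[set w | e u w & e w v]| <= nth 0 c 1)%N.
Proof.
case=> _ _ _ _ regc size_c u v neq_uv nadj.
have [->|[w0]] := set_0Vmem [set w | e u w & e w v]; first by rewrite cards0.
rewrite inE => /andP[euw0 ew0v].
have dist2 : at_distance e 2 u v by apply: (at_distance2 _ w0).
rewrite -(regc 2 u v size_c dist2); apply/subset_leq_card/subsetP => w.
by rewrite !inE at_distance1_irr (sym v) andbC.
Qed.

End DistanceRegular.

(** * Vector spaces over the field with two elements *)

Section CharTwo.
Context {V : lmodType 'F_2}.

Lemma addvv_F2 (x : V) : x + x = 0.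
Proof. by rewrite -mulr2n -scaler_nat pchar_Zp ?scale0r. Qed.

Lemma addvK_F2 (y x : V) : x + y + y = x.
Proof. by rewrite -addrA addvv_F2 addr0. Qed.

Lemma addv_eq0_F2 (x y : V) : (x + y == 0) = (x == y).
Proof. by rewrite -(inj_eq (addIr y)) addvK_F2 add0r. Qed.

End CharTwo.

(** * Paths of length two in the crooked graph *)

Section EdgeLabel.
Context {V : lmodType 'F_2} (f : V -> V).

Definition edge_label (p q : V * 'F_2) : V :=
  f (p.1 + q.1) + (p.2 + q.2 + 1) *: (f p.1 + f q.1).

Lemma crooked_graph_label (p q : V * 'F_2) alpha beta : p != q ->
  crooked_graph f (p, alpha) (q, beta) = (alpha + beta == edge_label p q).
Proof.
case: p q => [a i] [b j] neq_pq.
by rewrite /crooked_graph -pair_eqE /= negb_and neq_pq.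
Qed.

Lemma edge_label_id p : f 0 = 0 -> edge_label p p = 0.
Proof. by move=> f0; rewrite /edge_label !addvv_F2 f0 scaler0 addr0. Qed.

Lemma edge_label_two_step (x d c : V) (k : 'F_2) :
  edge_label (x, 0) (c, k) + edge_label (c, k) (x + d, 0) =
  f (c + x) + f (c + x + d) + (k + 1) *: (f x + f (x + d)).
Proof.
rewrite /edge_label /= add0r addr0 addrACA -scalerDr (addrC x c) addrA.
by rewrite [f x + f c + _]addrA addvK_F2.
Qed.

End EdgeLabel.

Section TwoStep.
Context {V : vectType 'F_2} {f : V -> V} (f0 : f 0 = 0).
Let e : rel (crooked_vertex V) := crooked_graph f.
Hypothesis triangle_free : forall u v w, e u v -> e v w -> ~~ e u w.
Hypothesis common_le2 : forall u v : crooked_vertex V, u != v -> ~~ e u v ->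
  (#|[set w | e u w & e w v]| <= 2)%N.

(** A fibre [r] other than [p] and [q] that gives the value [t] carries a common
    neighbour of [(p, 0)] and [(q, t)]. If these two vertices are adjacent there
    is none, and only [p] and [q] are left; if they are not, [p] and [q] do not
    give the value [t], and there are at most two common neighbours. *)
Lemma size_two_step_le2 (p q : V * 'F_2) (t : V) (s : seq (V * 'F_2)) :
  p != q -> uniq s ->
  {in s, forall r, edge_label f p r + edge_label f r q = t} ->
  (size s <= 2)%N.
Proof.
move=> neq_pq uniq_s label_s.
pose lift r : crooked_vertex V := (r, edge_label f p r).
have adj_p r : p != r -> e (p, 0) (lift r).
  by move=> neq_pr; rewrite /e crooked_graph_label // add0r.
have adj_q r : r \in s -> r != q -> e (lift r) (q, t).
  move=> s_r neq_rq; rewrite /e crooked_graph_label //.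
  by rewrite -(label_s r s_r) addrA addvv_F2 add0r.
have [t_pq|t_neq] := eqVneq t (edge_label f p q).
  apply: (@uniq_leq_size _ s [:: p; q] uniq_s) => r s_r; rewrite !inE.
  have [//|neq_rp] := eqVneq r p; have [//|neq_rq] := eqVneq r q.
  have neq_pr : p != r by rewrite eq_sym.
  have := triangle_free _ _ _ (adj_p r neq_pr) (adj_q r s_r neq_rq).
  by rewrite /e crooked_graph_label // add0r t_pq eqxx.
have inner r : r \in s -> (p != r) && (r != q).
  move=> s_r; apply/andP; split; apply: contraNneq t_neq.
    by move=> eq_pr; rewrite -(label_s r s_r) -eq_pr edge_label_id ?add0r.
  by move=> eq_rq; rewrite -(label_s r s_r) eq_rq edge_label_id ?addr0.
have uniq_lift : uniq (map lift s).
  by rewrite map_inj_uniq // => r r' [].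
rewrite -(size_map lift) -(card_uniqP uniq_lift).
have neq_uv : ((p, 0) : crooked_vertex V) != (q, t).
  by apply: contraNneq neq_pq => -[->].
have nadj : ~~ e (p, 0) (q, t) by rewrite /e crooked_graph_label // add0r.
apply: leq_trans (common_le2 _ _ neq_uv nadj).
apply/subset_leq_card/subsetP => _ /mapP[r s_r ->]; rewrite inE.
by have /andP[neq_pr neq_rq] := inner r s_r; rewrite adj_p ?adj_q.
Qed.

(** The case [p = (x, 0)], [q = (x + d, 0)] of the bound on two-step paths,
    after translating the middle fibre so that only the derivative
    [z |-> f z + f (z + d)] of [f] appears. *)
Lemma size_derivative_fibre_le2 (x d t : V) (s : seq (V * 'F_2)) :
  d != 0 -> uniq s ->
  {in s, forall r, f r.1 + f (r.1 + d) + r.2 *: (f x + f (x + d)) = t} ->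
  (size s <= 2)%N.
Proof.
move=> nz_d uniq_s fibre_s.
pose shift (r : V * 'F_2) : V * 'F_2 := (r.1 + x, r.2 - 1).
have neq_pq : (x, 0 : 'F_2) != (x + d, 0).
  apply: contraNneq nz_d => -[eq_x].
  by apply/eqP/(addrI x); rewrite -eq_x addr0.
rewrite -(size_map shift).
apply: (size_two_step_le2 _ _ t _ neq_pq).
  rewrite map_inj_uniq //.
  apply: (can_inj (g := fun r => (r.1 + x, r.2 + 1))) => -[z k].
  by rewrite /shift /= addvK_F2 subrK.
move=> _ /mapP[r s_r ->].
by rewrite edge_label_two_step addvK_F2 subrK fibre_s.
Qed.

End TwoStep.

(** * Crookedness *)

Theorem theorem5 (m : nat) (V : vectType 'F_2) (f : V -> V)
  (m_odd : odd m) (dimV : \dim {:V} = m) (f0 : f 0 = 0)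
  (drG : @distance_regular (crooked_vertex V) (crooked_graph f)
           [:: 2 ^ m.+1 - 1; 2 ^ m.+1 - 2; 1]%N [:: 1; 2; 2 ^ m.+1 - 1]%N) :
  crooked f.
Proof.
pose e : rel (crooked_vertex V) := crooked_graph f.
have irr : irreflexive e := crooked_graph_irrefl f.
have sym : symmetric e := crooked_graph_sym f.
have le_b : (2 ^ m.+1 - 1 <= (2 ^ m.+1 - 2).+1)%N by rewrite (subnS _ 1) leqSpred.
have triangle_free :=
  distance_regular_triangle_free irr sym _ _ drG isT le_b.
have common_le2 := distance_regular_common_neighbours irr sym _ _ drG isT.
have fibre_le2 := size_derivative_fibre_le2 f0 triangle_free common_le2.
split=> // [x y z neq_xy neq_xz neq_yz|x y z a nz_a]; apply/eqP => eq_f.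
  (* The derivative in direction [x + y] takes the value [f x + f y] at each of
     [x], [y] and [z]. *)
- have nz_d : x + y != 0 by rewrite addv_eq0_F2.
  pose s : seq (V * 'F_2) := [:: (x, 0); (y, 0); (z, 0)].
  have uniq_s : uniq s.
    by rewrite /= !inE -!pair_eqE /= !andbT negb_or neq_xy neq_xz neq_yz.
  suff /(fibre_le2 x _ (f x + f y) s nz_d uniq_s) :
    {in s, forall r, f r.1 + f (r.1 + (x + y)) +
                     r.2 *: (f x + f (x + (x + y))) = f x + f y} by [].
  move=> r; rewrite !inE => /or3P[] /eqP-> /=; rewrite scale0r addr0.
  + by rewrite addrA addvv_F2 add0r.
  + by rewrite [y + _]addrC addvK_F2 addrC.
  + by rewrite (addrC z) -eq_f addrC addvK_F2.
  (* The derivative [D] in direction [a] satisfies [D y = D (y + a)] and, by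
     [eq_f], [D y = D z + D x]. *)
- pose s : seq (V * 'F_2) := [:: (y, 0); (y + a, 0); (z, 1)].
  have uniq_s : uniq s.
    rewrite /= !inE -!pair_eqE /= !andbT !andbF !orbF andbT.
    by apply: contraNneq nz_a => eq_y; apply/eqP/(addrI y); rewrite -eq_y addr0.
  suff /(fibre_le2 x _ (f y + f (y + a)) s nz_a uniq_s) :
    {in s, forall r, f r.1 + f (r.1 + a) + r.2 *: (f x + f (x + a)) =
                     f y + f (y + a)} by [].
  move=> r; rewrite !inE => /or3P[] /eqP-> /=.
  + by rewrite scale0r addr0.
  + by rewrite scale0r addr0 addvK_F2 addrC.
  + rewrite scale1r; apply/eqP; rewrite -addv_eq0_F2.
    rewrite (addrACA (f z)) (addrACA (f z + f x)) addv_eq0_F2.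
    rewrite (addrC (f z)) (addrC (f (z + a)) (f (x + a))) addrAC eq_f.
    by rewrite [eqbRHS]addrAC.
Qed.
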